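(* Let $0<q<1$, let $\tau_{2n}(t)=1$ and $\tau_{2n+1}(t)=t$ for $n\ge 0$, and define polynomials $F_n(x,t,q)$ in $x$ by the recursion $$F_n(x,t,q)=x\,F_{n-1}(x,qt,q)-q^{\lfloor (n-1)/2\rfloor}\,\tau_{n-2}(t)\,F_{n-2}(x,t,q)\qquad(n\ge 2)$$ with initial values $F_0(x,t,q)=1$ and $F_1(x,t,q)=x$. Then these polynomials are explicitly given, for all $n\ge 0$, by $$F_{2n}(x,t,q)=\sum_{k=0}^{n}(-1)^k q^{\binom k2}\sum_{j=0}^{k}\begin{bmatrix} n-j\\ k-j\end{bmatrix}\begin{bmatrix} n-k+j-1\\ j\end{bmatrix}q^{(n-k+1)j}t^j\,x^{2n-2k},$$ $$F_{2n+1}(x,t,q)=\sum_{k=0}^{n}(-1)^k q^{\binom k2}\sum_{j=0}^{k}\begin{bmatrix} n-j\\ k-j\end{bmatrix}\begin{bmatrix} n-k+j\\ j\end{bmatrix}q^{(n-k+1)j}t^j\,x^{2n+1-2k}.$$ Moreover, if $L$ denotes the linear functional on polynomials in $x$ defined by $L(F_n(x,t,q))=[n=0]$ for all $n\ge 0$, then for all $n\ge 0$ $$L(x^{2n})=C_n(t,q)\quad\text{and}\quad L(x^{2n+1})=0,$$ where $C_0(t,q)=1$ and, for $n>0$, $$C_n(t,q)=\frac{1}{[n]}\sum_{j=0}^{n}q^{j^2+j}\begin{bmatrix} n\\ j\end{bmatrix}\begin{bmatrix} n\\ j+1\end{bmatrix}t^j .$$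
   Context: Throughout $q$ is a real number with $0<q<1$, and $t$ is an indeterminate; $F_{n-1}(x,qt,q)$ means that $t$ is replaced by $qt$ in $F_{n-1}(x,t,q)$. Notation: $[n]=\frac{1-q^n}{1-q}$; $(q;q)_n=\prod_{i=1}^n(1-q^i)$; the $q$-binomial coefficient is $\begin{bmatrix} n\\ k\end{bmatrix}=\frac{(q;q)_n}{(q;q)_k(q;q)_{n-k}}$ for $0\le k\le n$, it is $0$ if $k<0$ or $k>n\ge 0$, and $\begin{bmatrix} m\\ 0\end{bmatrix}=1$ for every integer $m$ (in particular $\begin{bmatrix} -1\\ 0\end{bmatrix}=1$). The Iverson bracket $[n=0]$ equals $1$ if $n=0$ and $0$ otherwise. The functional $L$ is linear over the coefficients (the field $\mathbb{R}(t)$ of rational functions in $t$), acting on polynomials in $x$; it is well defined since $F_n(x,t,q)$ is monic of degree $n$ in $x$. *)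

(* Defs.v *)
From HB Require Import structures.
From mathcomp Require Import all_boot all_order all_algebra.
From mathcomp Require Import reals.

Set Implicit Arguments.
Unset Strict Implicit.
Unset Printing Implicit Defensive.

Import Order.TTheory GRing.Theory Num.Theory.
Local Open Scope ring_scope.

(* An element of {poly {poly R}} is a polynomial in x (the outer variable)
   whose coefficients are polynomials in t (the inner variable). *)

Definition qnum (R : realType) (q : R) (n : nat) : R :=
  (1 - q ^+ n) / (1 - q).

Definition qpoch (R : realType) (q : R) (n : nat) : R :=
  \prod_(1 <= i < n.+1) (1 - q ^+ i).

(* Integer arguments, because the formula for F_2n involves [-1 choose 0] = 1.
   The value 0 at m < 0 < k is a convention that no formula relies on. *)
Definition qbinom (R : realType) (q : R) (m k : int) : R :=
  if 0 <= k <= m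
  then qpoch q `|m|%N / (qpoch q `|k|%N * qpoch q `|m - k|%N)
  else if k == 0 then 1 else 0.

Definition tau (R : realType) (n : nat) : {poly R} :=
  if odd n then 'X else 1.

(* The substitution t := q t. *)
Definition qshift (R : realType) (q : R) (p : {poly {poly R}}) :
    {poly {poly R}} :=
  map_poly (fun c : {poly R} => c \Po (q *: 'X)) p.

(* In the last case n = m.+2, so m.+1./2 is the floor of (n - 1) / 2. *)
Fixpoint F (R : realType) (q : R) (n : nat) : {poly {poly R}} :=
  match n with
  | 0 => 1
  | 1 => 'X
  | (m.+1 as n1).+1 =>
      'X * qshift q (F q n1) - (q ^+ (m.+1)./2 *: tau R m) *: F q m
  end.

Definition Catalan (R : realType) (q : R) (n : nat) : {poly R} :=
  if n == 0%N then 1 else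
  (qnum q n)^-1 *:
    \sum_(0 <= j < n.+1)
      (q ^+ (j ^ 2 + j) * qbinom q n%:Z j%:Z * qbinom q n%:Z (j.+1)%:Z) *: 'X^j.


Definition Frat (R : realType) (q : R) (n : nat) : {poly {fraction {poly R}}} :=
  map_poly (@tofrac {poly R}) (F q n).

Definition is_dual_functional (R : realType) (q : R)
    (L : {scalar {poly {fraction {poly R}}}}) : Prop :=
  forall n : nat, L (Frat q n) = (n == 0%N)%:R.

(* Main.v *)
(* The explicit formulas satisfy the recursion for F by the two q-Pascal rules.
   Read with q t in place of t on the left, the recursion says
     x F_k(x, q t) = F_(k+1)(x, t) + q^floor(k/2) tau_(k-1)(t) F_(k-1)(x, t),
   so the coefficients a(n, k) of the expansion x^n = sum_k a(n, k) F_k obey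
     a(n+1, k)(t) = a(n, k-1)(q t) + q^floor((k+1)/2) tau_k(t) a(n, k+1)(q t).
   Applying L gives L(x^n) = a(n, 0).  With N = n+1 and K = k+1, the coefficient
   of t^j in a(2n+1, 2k+1) is a q-ballot number
     q^(j (j+K-1)) [K]/[N] [N choose j] [N choose j+K];
   this follows from the two-step recursion in n, and K = 1 gives the q-Narayana
   numbers in C_N. *)

Require Import Defs.
From HB Require Import structures.
From mathcomp Require Import all_boot all_order all_algebra.
From mathcomp Require Import reals.
From mathcomp Require Import zify ring.

Set Implicit Arguments.
Unset Strict Implicit.
Unset Printing Implicit Defensive.

Import Order.TTheory GRing.Theory Num.Theory.
Local Open Scope ring_scope.

(** * q-binomial coefficients and q-ballot numbers *)

Section QBinomials.
Variables (R : realType) (q : R).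
Hypotheses (hq0 : 0 < q) (hq1 : q < 1).

Lemma one_sub_qexp_neq0 n : 1 - q ^+ n.+1 != 0.
Proof. by rewrite subr_eq0 eq_sym lt_eqF // exprn_ilt1 // ltW. Qed.

Lemma qpochS n : qpoch q n.+1 = qpoch q n * (1 - q ^+ n.+1).
Proof. by rewrite /qpoch big_nat_recr. Qed.

Lemma qpoch_neq0 n : qpoch q n != 0.
Proof.
elim: n => [|n IHn]; first by rewrite /qpoch big_geq ?oner_neq0.
by rewrite qpochS mulf_neq0 // one_sub_qexp_neq0.
Qed.

Lemma qbinom_nat n k : (k <= n)%N ->
  qbinom q n%:Z k%:Z = qpoch q n / (qpoch q k * qpoch q (n - k)).
Proof. by move=> le_kn; rewrite /qbinom !lez_nat le_kn /= subzn. Qed.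

Lemma qbinom0 (m : int) : qbinom q m 0 = 1.
Proof.
case: m => [n|n]; last by [].
rewrite (@qbinom_nat n 0) // subn0 {2}/qpoch big_geq // mul1r divff //.
exact: qpoch_neq0.
Qed.

Lemma qbinom_small (n k : nat) : (n < k)%N -> qbinom q n%:Z k%:Z = 0.
Proof. by case: k => // k; rewrite /qbinom !lez_nat ltnNge => /negbTE->. Qed.

Lemma qbinom_diag n : qbinom q n%:Z n%:Z = 1.
Proof.
rewrite qbinom_nat // subnn {3}/qpoch big_geq // mulr1 divff //.
exact: qpoch_neq0.
Qed.

(** Together with [qbinom_absorb] this writes neighbouring entries of row n as rational multiples of
    one entry of row n + 1, so that q-binomial identities become identities between powers of q that
    [field] can settle. *)
Lemma qbinom_absorb_top n k :
  qbinom q n%:Z k%:Z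
  = (1 - q ^+ k.+1) / (1 - q ^+ n.+1) * qbinom q n.+1%:Z k.+1%:Z.
Proof.
case: (leqP k n) => [le_kn|lt_nk]; last by rewrite !qbinom_small ?mulr0.
rewrite !qbinom_nat // subSS !qpochS; field.
by rewrite !qpoch_neq0 !one_sub_qexp_neq0.
Qed.

(* Multiplied by [q ^+ k], so that the exponent n + 1 - k does not appear. *)
Lemma qbinom_absorb n k :
  qbinom q n%:Z k%:Z
  = (q ^+ k - q ^+ n.+1) / (q ^+ k * (1 - q ^+ n.+1))
    * qbinom q n.+1%:Z k%:Z.
Proof.
case: (ltngtP k n.+1) => [lt_kn|lt_nk|->]; last first.
- by rewrite qbinom_small // subrr !mul0r.
- by rewrite !qbinom_small ?mulr0 // ltnW.
rewrite ltnS in lt_kn.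
rewrite !qbinom_nat ?(leqW lt_kn) // subSn // !qpochS.
have -> : q ^+ n.+1 = q ^+ k * q ^+ (n - k).+1 by rewrite -exprD addnS subnKC.
have qk : q ^+ k != 0 by rewrite expf_neq0 // gt_eqF.
have := one_sub_qexp_neq0 n.
have -> : q ^+ n.+1 = q ^+ k * q ^+ (n - k).+1 by rewrite -exprD addnS subnKC.
move=> qn; field.
by rewrite !qpoch_neq0 ?one_sub_qexp_neq0 qn qk.
Qed.

(** After absorption both q-Pascal rules are a telescoping numerator; here it is (1 - q^(k+1)) +
    (q^(k+1) - q^(n+1)) = 1 - q^(n+1). *)
Lemma qbinomS n k : qbinom q n.+1%:Z k.+1%:Z
  = qbinom q n%:Z k%:Z + q ^+ k.+1 * qbinom q n%:Z k.+1%:Z.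
Proof.
rewrite (qbinom_absorb_top n k) (qbinom_absorb n k.+1); field.
by rewrite one_sub_qexp_neq0 expf_neq0 // gt_eqF.
Qed.

Lemma qbinomS_sym n k : qbinom q n.+1%:Z k.+1%:Z
  = q ^+ (n - k) * qbinom q n%:Z k%:Z + qbinom q n%:Z k.+1%:Z.
Proof.
case: (leqP k n) => [le_kn|lt_nk]; last first.
  by rewrite !qbinom_small ?mulr0 ?addr0 // ltnW.
rewrite (qbinom_absorb_top n k) (qbinom_absorb n k.+1).
have := one_sub_qexp_neq0 n.
have -> : q ^+ n.+1 = q ^+ (n - k) * q ^+ k.+1 by rewrite -exprD addnS subnK.
move=> qn; field.
by rewrite qn expf_neq0 // gt_eqF.
Qed.

(** The arguments [n] and [k] are the shifted N and K of the overview. The truncated predecessor has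
    an effect only at j = k = 0, where the factor j makes the exponent 0 anyway. *)
Definition qballot (n k j : nat) : R :=
  q ^+ (j * (j + k).-1) * ((1 - q ^+ k) / (1 - q ^+ n))
  * (qbinom q n%:Z j%:Z * qbinom q n%:Z (j + k)%:Z).

Lemma qballot0 n j : qballot n 0 j = 0.
Proof. by rewrite /qballot expr0 subrr !(mulr0, mul0r). Qed.

Lemma qballotS0 n k : qballot n.+2 k.+1 0
  = qballot n.+1 k 0 + q ^+ k * qballot n.+1 k.+1 0.
Proof.
rewrite /qballot !add0n !mul0n !qbinom0 (qbinom_absorb_top n.+1 k).
rewrite (qbinom_absorb n.+1 k.+1) !(exprS q _.+1) (exprS q k); field.
have := one_sub_qexp_neq0 n.+1; have := one_sub_qexp_neq0 n.
rewrite !exprS => qn1 qn2.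
by rewrite qn1 qn2 expf_neq0 gt_eqF.
Qed.

(** Absorption turns all four terms on the right into multiples of the product [n+2 choose j+1]
    [n+2 choose j+k+2] on the left; what remains is rational in powers of q. The squares come from
    the two dilations t := q t in two steps of the recursion for [xcoef]. *)
Lemma qballotSS n k j : qballot n.+2 k.+1 j.+1
  = q ^+ j.+1 ^+ 2
    * (qballot n.+1 k j.+1 + q ^+ k * qballot n.+1 k.+1 j.+1)
    + q ^+ k.+1 * q ^+ j ^+ 2
      * (qballot n.+1 k.+1 j + q ^+ k.+1 * qballot n.+1 k.+2 j).
Proof.
rewrite /qballot !addSn !addnS /= !mulSn !mulnS !exprD.
rewrite (qbinom_absorb_top n.+1 j) (qbinom_absorb_top n.+1 (j + k).+1).
rewrite (qbinom_absorb n.+1 j.+1) (qbinom_absorb n.+1 (j + k).+2).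
have := one_sub_qexp_neq0 n.+1; have := one_sub_qexp_neq0 n.
rewrite !exprS !exprD => qn1 qn2; field.
by rewrite qn1 qn2 !expf_neq0 ?gt_eqF.
Qed.
End QBinomials.

(** * Coefficients in t and the dilation t := q t *)

Lemma coef_sum_scale_Xn (R : nzSemiRingType) (a : nat -> R) m j :
  (\sum_(0 <= i < m) a i *: 'X^i)`_j = if (j < m)%N then a j else 0.
Proof. by rewrite big_mkord -poly_def coef_poly. Qed.

Section Dilation.
Variables (R : realType) (q : R).
Implicit Types (c : {poly R}) (p : {poly {poly R}}).

Lemma coef_dilate c i : (c \Po (q *: 'X))`_i = q ^+ i * c`_i.
Proof.
rewrite coef_comp_poly.
under eq_bigr => k _ do rewrite exprZn coefZ coefXn.
case: (ltnP i (size c)) => [lt_ic|le_ci].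
  rewrite (bigD1 (Ordinal lt_ic)) //= eqxx mulr1 big1 ?addr0 1?mulrC //.
  move=> k neq_ki; case: eqP => [eq_ik|_]; last by rewrite !mulr0.
  by case/eqP: neq_ki; apply: val_inj.
rewrite nth_default // mulr0 big1 // => k _.
by rewrite gtn_eqF ?mulr0 // (leq_trans (ltn_ord k)).
Qed.

Lemma qshift_sum (I : Type) (r : seq I) (P : pred I)
    (E : I -> {poly {poly R}}) :
  qshift q (\sum_(i <- r | P i) E i) = \sum_(i <- r | P i) qshift q (E i).
Proof. exact: (rmorph_sum (map_poly (comp_poly (q *: 'X)))). Qed.

Lemma qshiftZ c p : qshift q (c *: p) = (c \Po (q *: 'X)) *: qshift q p.
Proof. exact: (map_polyZ (comp_poly (q *: 'X))). Qed.

Lemma qshiftD p1 p2 : qshift q (p1 + p2) = qshift q p1 + qshift q p2.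
Proof. exact: (rmorphD (map_poly (comp_poly (q *: 'X)))). Qed.

Lemma qshiftXn n : qshift q 'X^n = 'X^n.
Proof. exact: (map_polyXn (comp_poly (q *: 'X))). Qed.

Lemma F_rec n : F q n.+2
  = 'X * qshift q (F q n.+1) - (q ^+ (n.+1)./2 *: tau R n) *: F q n.
Proof. by []. Qed.
End Dilation.

(** * The explicit formulas for F_2n and F_(2n+1) *)

Section ExplicitFormula.
Variables (R : realType) (q : R).
Hypotheses (hq0 : 0 < q) (hq1 : q < 1).

Definition even_coef (n k : nat) : {poly R} :=
  ((-1) ^+ k * q ^+ 'C(k, 2)) *:
    \sum_(0 <= j < k.+1)
      (qbinom q (n%:Z - j%:Z) (k%:Z - j%:Z)
       * qbinom q (n%:Z - k%:Z + j%:Z - 1) j%:Z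
       * q ^+ ((n - k + 1) * j)) *: 'X^j.

Definition odd_coef (n k : nat) : {poly R} :=
  ((-1) ^+ k * q ^+ 'C(k, 2)) *:
    \sum_(0 <= j < k.+1)
      (qbinom q (n%:Z - j%:Z) (k%:Z - j%:Z)
       * qbinom q (n%:Z - k%:Z + j%:Z) j%:Z
       * q ^+ ((n - k + 1) * j)) *: 'X^j.

Lemma coef_even_coef n k j : (even_coef n k)`_j =
  if (j <= k)%N then
    (-1) ^+ k * q ^+ 'C(k, 2) *
    (qbinom q (n%:Z - j%:Z) (k%:Z - j%:Z)
     * qbinom q (n%:Z - k%:Z + j%:Z - 1) j%:Z
     * q ^+ ((n - k + 1) * j))
  else 0.
Proof.
by rewrite coefZ coef_sum_scale_Xn ltnS; case: ifP; rewrite ?mulr0.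
Qed.

Lemma coef_odd_coef n k j : (odd_coef n k)`_j =
  if (j <= k)%N then
    (-1) ^+ k * q ^+ 'C(k, 2) *
    (qbinom q (n%:Z - j%:Z) (k%:Z - j%:Z)
     * qbinom q (n%:Z - k%:Z + j%:Z) j%:Z
     * q ^+ ((n - k + 1) * j))
  else 0.
Proof.
by rewrite coefZ coef_sum_scale_Xn ltnS; case: ifP; rewrite ?mulr0.
Qed.

Lemma even_coef0 n : even_coef n 0 = 1.
Proof.
rewrite /even_coef big_nat1 !expr0 !mulr1 muln0 expr0 !mulr1 !subrr.
by rewrite !qbinom0 // mulr1 !scale1r.
Qed.

Lemma odd_coef0 n : odd_coef n 0 = 1.
Proof.
rewrite /odd_coef big_nat1 !expr0 !mulr1 muln0 expr0 !mulr1 !subrr.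
by rewrite !qbinom0 // mulr1 !scale1r.
Qed.

(** Pads the odd formula with a zero term, so that the recursion can be compared termwise down to
    the constant term of F_(2n+2). For j <= n the first q-binomial vanishes; at j = n + 1 it is
    [-1 choose 0] = 1, and the second one, [n choose n+1], vanishes instead. *)
Lemma odd_coef_small n : odd_coef n n.+1 = 0.
Proof.
apply/polyP => j; rewrite coef_odd_coef coef0; case: ifP => // le_jn.
have -> : n%:Z - n.+1%:Z + j%:Z = j%:Z - 1 by lia.
move: le_jn; rewrite leq_eqVlt => /predU1P[->|lt_jn].
  have -> : n.+1%:Z - 1 = n%:Z by lia.
  by rewrite (@qbinom_small _ _ n) // !(mulr0, mul0r).
have -> : n%:Z - j%:Z = (n - j)%N%:Z by lia.
have -> : n.+1%:Z - j%:Z = (n - j).+1%N%:Z by lia.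
by rewrite qbinom_small // !(mulr0, mul0r).
Qed.

(** At t^j with j <= k the three terms share their second q-binomial, and [qbinomS_sym] applies to
    the first. At j = k + 1 the term in [even_coef n k] is absent and only powers of q are
    compared. *)
Lemma even_coefS n k : (k <= n)%N ->
  even_coef n.+1 k.+1
  = (odd_coef n k.+1 \Po (q *: 'X)) - q ^+ n *: even_coef n k.
Proof.
move=> le_kn; apply/polyP => j.
rewrite coefB coef_dilate (coefZ (q ^+ n)) !coef_even_coef coef_odd_coef.
case: (ltngtP j k.+1) => [lt_jk|lt_kj|->]; last 2 first.
- by rewrite leqNgt (ltnW lt_kj) !mulr0 subr0.
- rewrite ltnn subrr !qbinom0 // !mul1r mulr0 subr0.
  have -> : n.+1%:Z - k.+1%:Z + k.+1%:Z - 1 = n%:Z by lia.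
  have -> : n%:Z - k.+1%:Z + k.+1%:Z = n%:Z by lia.
  (* At k = n the natural subtraction n - (k + 1) truncates and spoils the exponent of q, but there
     a q-binomial factor is 0. The same split recurs below for j <= k. *)
  case: (ltnP k n) => [lt_kn|le_nk].
    rewrite subSS; have -> : (n - k = (n - k.+1).+1)%N by lia.
    by rewrite !addn1 (mulSn (n - k.+1).+1) exprD; ring.
  by rewrite (@qbinom_small _ _ n) // !(mulr0, mul0r).
- rewrite -ltnS lt_jk.
  have -> : n.+1%:Z - k.+1%:Z + j%:Z - 1 = n%:Z - k%:Z + j%:Z - 1 by lia.
  have -> : n%:Z - k.+1%:Z + j%:Z = n%:Z - k%:Z + j%:Z - 1 by lia.
  have -> : n.+1%:Z - j%:Z = (n - j).+1%N%:Z by lia.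
  have -> : k.+1%:Z - j%:Z = (k - j).+1%N%:Z by lia.
  have -> : n%:Z - j%:Z = (n - j)%N%:Z by lia.
  have -> : k%:Z - j%:Z = (k - j)%N%:Z by lia.
  set b := qbinom q (_ - 1) _.
  rewrite qbinomS_sym // (_ : n - j - (k - j) = n - k)%N; last by lia.
  rewrite subSS binS bin1.
  have eq_n : q ^+ n = q ^+ (n - k) * q ^+ k by rewrite -exprD subnK.
  case: (ltnP k n) => [lt_kn|le_nk].
    have -> : (n - k = (n - k.+1).+1)%N by lia.
    rewrite eq_n; have -> : (n - k = (n - k.+1).+1)%N by lia.
    by rewrite !addn1 !mulSn !exprD !exprS; ring.
  have -> : k = n by lia.
  rewrite (@qbinom_small _ _ (n - j) (n - j).+1) // subnn !addn1.
  by rewrite !exprD !exprS expr0; ring.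
Qed.

(** Here the first q-binomial is shared and [qbinomS] applies to the second: the dilation supplies
    its factor q^(j+1), and the factor t lowers the index j + 1 to j in [odd_coef n k]. *)
Lemma odd_coefS n k : (k <= n)%N ->
  odd_coef n.+1 k.+1
  = (even_coef n.+1 k.+1 \Po (q *: 'X)) - (q ^+ n.+1 *: 'X) * odd_coef n k.
Proof.
move=> le_kn; apply/polyP => j.
rewrite coefB coef_dilate -scalerAl (coefZ (q ^+ n.+1)) coefXM.
rewrite !coef_even_coef !coef_odd_coef.
case: j => [|j].
  by rewrite eqxx !muln0 !qbinom0 // expr0 mulr0 !subr0 mul1r.
have -> : (j.+1 == 0)%N = false by []. rewrite [j.+1.-1]/=.
rewrite ltnS; case: (leqP j k) => [le_jk|]; last by rewrite !mulr0 subr0.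
have -> : n.+1%:Z - k.+1%:Z + j.+1%:Z = (n - k + j).+1%N%:Z by lia.
have -> : (n - k + j).+1%N%:Z - 1 = (n - k + j)%N%:Z by lia.
have -> : n.+1%:Z - j.+1%:Z = n%:Z - j%:Z by lia.
have -> : k.+1%:Z - j.+1%:Z = k%:Z - j%:Z by lia.
have -> : n%:Z - k%:Z + j%:Z = (n - k + j)%N%:Z by lia.
rewrite qbinomS // subSS binS bin1.
have -> : q ^+ n.+1 = q ^+ (n - k + 1) * q ^+ k.
  by rewrite -exprD; congr (_ ^+ _); lia.
by rewrite mulnS !exprD !exprS; ring.
Qed.

Lemma F_explicit n :
  F q (2 * n) = \sum_(0 <= k < n.+1) even_coef n k *: 'X^(2 * n - 2 * k)
  /\ F q (2 * n + 1)
     = \sum_(0 <= k < n.+1) odd_coef n k *: 'X^(2 * n + 1 - 2 * k).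
Proof.
elim: n => [|n [IHe IHo]].
  by rewrite !big_nat1 even_coef0 odd_coef0 !scale1r.
have Fe : F q (2 * n.+1)
    = \sum_(0 <= k < n.+2) even_coef n.+1 k *: 'X^(2 * n.+1 - 2 * k).
  have -> : (2 * n.+1 = (2 * n).+2)%N by lia.
  rewrite F_rec -{1}addn1 IHe IHo.
  have -> : ((2 * n).+1)./2 = n by lia.
  have -> : tau R (2 * n) = 1 by rewrite /tau oddM.
  rewrite [in LHS]big_nat_recl // [in RHS]big_nat_recl // odd_coef0 even_coef0.
  rewrite !scale1r !muln0 !subn0 qshiftD qshiftXn mulrDr -exprS addn1 -addrA.
  congr (_ + _).
  rewrite qshift_sum mulr_sumr.
  have -> : \sum_(0 <= k < n)
       'X * qshift q (odd_coef n k.+1 *: 'X^((2 * n).+1 - 2 * k.+1))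
     = \sum_(0 <= k < n.+1)
         (odd_coef n k.+1 \Po (q *: 'X)) *: 'X^(2 * n - 2 * k).
    rewrite [RHS]big_nat_recr //= odd_coef_small comp_poly0 scale0r addr0.
    apply: eq_big_nat => k /andP[_ lt_kn].
    rewrite qshiftZ qshiftXn -scalerAr -exprS.
    by congr (_ *: 'X^_); lia.
  rewrite scaler_sumr -sumrB; apply: eq_big_nat => k /andP[_ lt_kn].
  rewrite even_coefS // scalerBl scalerA.
  by rewrite -scalerAl mul1r; congr (_ *: 'X^_ - _ *: 'X^_); lia.
split=> //.
have -> : (2 * n.+1 + 1 = (2 * n + 1).+2)%N by lia.
rewrite F_rec IHo (_ : (2 * n + 1).+1 = 2 * n.+1)%N; last by lia.
rewrite Fe (_ : (2 * n.+1)./2 = n.+1)%N; last by lia.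
have -> : tau R (2 * n + 1) = 'X by rewrite /tau addn1 /= oddM.
rewrite big_nat_recl // [in RHS]big_nat_recl // odd_coef0 even_coef0.
rewrite !scale1r !muln0 !subn0 qshiftD qshiftXn mulrDr -exprS -addrA.
congr (_ + _).
rewrite qshift_sum mulr_sumr scaler_sumr -sumrB.
apply: eq_big_nat => k /andP[_ lt_kn].
rewrite odd_coefS // scalerBl scalerA qshiftZ qshiftXn -scalerAr -exprS.
by congr (_ *: 'X^_ - _ *: 'X^_); lia.
Qed.
End ExplicitFormula.

(** * Expansion of x^n in the basis F_k *)

Section PowersOfX.
Variables (R : realType) (q : R).

(* The coefficient of [F q k] in ['X^n]. *)
Fixpoint xcoef (n k : nat) : {poly R} :=
  if n is m.+1 then
    (if k is l.+1 then xcoef m l \Po (q *: 'X) else 0)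
    + (q ^+ (k.+1)./2 *: tau R k) * (xcoef m k.+1 \Po (q *: 'X))
  else (k == 0%N)%:R.

Lemma xcoefS n k : xcoef n.+1 k =
  (if k is l.+1 then xcoef n l \Po (q *: 'X) else 0)
  + (q ^+ (k.+1)./2 *: tau R k) * (xcoef n k.+1 \Po (q *: 'X)).
Proof. by []. Qed.

Lemma xcoef_small n k : (n < k)%N -> xcoef n k = 0.
Proof.
elim: n k => [|n IHn] [|k] // lt_nk; rewrite xcoefS.
by rewrite !IHn ?comp_poly0 ?mulr0 ?addr0 //; lia.
Qed.

Lemma xcoef_diag n : xcoef n n = 1.
Proof.
elim: n => [|n IHn] //; rewrite xcoefS IHn xcoef_small //.
rewrite comp_poly0 mulr0 addr0.
exact: (rmorph1 (comp_poly (q *: 'X))).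
Qed.

Lemma xcoef_odd n k : odd (n + k) -> xcoef n k = 0.
Proof.
elim: n k => [|n IHn] [|k] // odd_nk; rewrite xcoefS.
  by rewrite IHn ?comp_poly0 ?mulr0 ?addr0 // addn1 -[n]addn0.
by rewrite !IHn ?comp_poly0 ?mulr0 ?addr0 //; lia.
Qed.

Lemma Xn_expand n : 'X^n = \sum_(k < n.+1) xcoef n k *: F q k.
Proof.
elim: n => [|n IHn]; first by rewrite big_ord1 scale1r.
(* Since x^n is free of t, the induction hypothesis may be read with q t in place of t. *)
rewrite exprS -(qshiftXn q) IHn qshift_sum mulr_sumr.
pose a k := xcoef n k \Po (q *: 'X).
pose w k : {poly R} := q ^+ (k.+1)./2 *: tau R k.
have a_small k : (n < k)%N -> a k = 0.
  by move=> lt_nk; rewrite /a xcoef_small // comp_poly0.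
have -> : \sum_(k < n.+2) xcoef n.+1 k *: F q k
    = \sum_(k < n.+1) a k *: F q k.+1 + \sum_(k < n) (a k.+1 * w k) *: F q k.
  under eq_bigr => k _ do rewrite xcoefS scalerDl.
  rewrite big_split /=; congr (_ + _).
    by rewrite big_ord_recl scale0r add0r.
  rewrite !big_ord_recr /= -/(a _) -/(a _) !a_small // !mulr0 !scale0r !addr0.
  by apply: eq_bigr => k _; rewrite mulrC.
under eq_bigr => k _ do rewrite qshiftZ -scalerAr.
(* The term k = 0 is x F_0 = F_1, from the initial values; all later terms use the recursion, which
   starts at F_2. *)
rewrite [LHS]big_ord_recl [X in _ = X + _]big_ord_recl -addrA; congr (_ + _).
  by congr (_ *: _); have /= -> := qshiftXn q 0; rewrite mulr1.
rewrite -big_split; apply: eq_bigr => k _.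
by rewrite !lift0 F_rec -/(a _) -/(w _) scalerBr scalerA [RHS]subrK.
Qed.
End PowersOfX.

(** * Closed forms for the expansion coefficients *)

Section Moments.
Variables (R : realType) (q : R).
Hypotheses (hq0 : 0 < q) (hq1 : q < 1).

Lemma coef_xcoef_odd n k j :
  (xcoef q (2 * n + 1) (2 * k + 1))`_j = qballot q n.+1 k.+1 j.
Proof.
elim: n k j => [|n IHn] k j.
  rewrite (_ : 2 * 0 + 1 = 1)%N // addn1 xcoefS.
  rewrite (@xcoef_small _ _ 0 (2 * k).+2) // comp_poly0 mulr0 addr0.
  rewrite /= -polyC_natr comp_polyC coefC /qballot.
  case: j => [|j].
    rewrite mul0n add0n qbinom0 // expr0 !mul1r; case: k => [|k].
      by rewrite qbinom_diag // mulr1 divff // (one_sub_qexp_neq0 hq0 hq1 0).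
    by rewrite (@qbinom_small _ _ 1 k.+2) ?mulr0.
  by rewrite (@qbinom_small _ _ 1 (j.+1 + k.+1)) ?addnS ?mulr0.
(* The intermediate even row is kept as a sum of two q-ballot numbers. At l = 0 the left neighbour
   in [xcoef] is missing, in agreement with [qballot0]. *)
have even_xcoef l i : (xcoef q (2 * n + 2) (2 * l))`_i
    = q ^+ i * (qballot q n.+1 l i + q ^+ l * qballot q n.+1 l.+1 i).
  rewrite (_ : 2 * n + 2 = (2 * n + 1).+1)%N; last by lia.
  rewrite xcoefS -(addn1 (2 * l)) coefD.
  have -> : (2 * l + 1)./2 = l by lia.
  have -> : tau R (2 * l) = 1 by rewrite /tau oddM.
  rewrite -scalerAl mul1r coefZ coef_dilate IHn.
  case: l => [|l].
    by rewrite muln0 coef0 qballot0 expr0 !mul1r !add0r.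
  have -> : (2 * l.+1 = (2 * l + 1).+1)%N by lia.
  by rewrite coef_dilate IHn; ring.
rewrite (_ : 2 * n.+1 + 1 = (2 * n + 2).+1)%N; last by lia.
rewrite addn1 xcoefS coefD coef_dilate even_xcoef.
have -> : ((2 * k).+2)./2 = k.+1 by lia.
have -> : tau R (2 * k).+1 = 'X by rewrite /tau /= oddM.
have -> : ((2 * k).+2 = 2 * k.+1)%N by lia.
rewrite -scalerAl coefZ coefXM.
case: j => [|j] /=.
  by rewrite mulr0 addr0 expr0 !mul1r qballotS0.
by rewrite coef_dilate even_xcoef qballotSS // !mulrA.
Qed.

(** For n > 0 the entry is the dilation of [xcoef q (2 * n - 1) 1], which raises the factor q^(j^2)
    of the q-ballot number with k = 1 to q^(j^2+j). *)
Lemma xcoef_Catalan n : xcoef q (2 * n) 0 = Catalan q n.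
Proof.
case: n => [|n] //; rewrite (_ : 2 * n.+1 = (2 * n + 1).+1)%N; last by lia.
apply/polyP => j.
rewrite xcoefS add0r expr0 scale1r mul1r -[1%N]/(2 * 0 + 1)%N.
rewrite coef_dilate coef_xcoef_odd /Catalan /= coefZ coef_sum_scale_Xn.
rewrite /qballot addn1 /= expr1 /qnum invf_div.
case: ltnP => [_|lt_nj].
  by rewrite mulnn exprD; ring.
by rewrite (@qbinom_small _ _ _ j) // !(mulr0, mul0r).
Qed.

Lemma xcoef_odd0 n : xcoef q (2 * n + 1) 0 = 0.
Proof. by apply: xcoef_odd; lia. Qed.
End Moments.

(** * Linear functionals with prescribed moments *)

Section LinearFunctionals.
Variable K : fieldType.

Lemma scalar_eq_on_Xn (L L' : {scalar {poly K}}) :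
  (forall n, L 'X^n = L' 'X^n) -> L =1 L'.
Proof.
move=> eqL p; rewrite -(coefK p) poly_def !linear_sum.
by apply: eq_bigr => i _; rewrite !linearZ eqL.
Qed.

Definition moment_functional (m : nat -> K) (p : {poly K}) : K :=
  \sum_(i < size p) p`_i * m i.

(** Linearity compares polynomials of different sizes, hence needs one common summation range. *)
Lemma moment_functional_widen m N (p : {poly K}) : (size p <= N)%N ->
  moment_functional m p = \sum_(i < N) p`_i * m i.
Proof.
move=> le_pN; rewrite /moment_functional.
rewrite (big_ord_widen _ (fun i => p`_i * m i) le_pN).
rewrite [RHS](bigID (fun i : 'I_N => (i < size p)%N)) /=.
rewrite [X in _ + X]big1 ?addr0 // => i.
by rewrite -leqNgt => le_pi; rewrite nth_default ?mul0r.
Qed.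

Lemma moment_functional_is_linear m : scalar (moment_functional m).
Proof.
move=> c p1 p2 /=.
pose N := maxn (size (c *: p1 + p2)) (maxn (size p1) (size p2)).
rewrite !(@moment_functional_widen _ N) ?leq_max ?leqnn ?orbT //.
rewrite mulr_sumr -big_split /=; apply: eq_bigr => i _.
by rewrite coefD coefZ mulrDl mulrA.
Qed.

HB.instance Definition _ m := GRing.isLinear.Build K {poly K} K *%R
  (moment_functional m) (moment_functional_is_linear m).

Lemma moment_functional_Xn m n : moment_functional m 'X^n = m n.
Proof.
rewrite /moment_functional size_polyXn big_ord_recr /= coefXn eqxx mul1r.
by rewrite big1 ?add0r // => i _; rewrite coefXn ltn_eqF ?mul0r.
Qed.
End LinearFunctionals.

(** * The functional dual to the F_n *)

Section DualFunctional.
Variables (R : realType) (q : R).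
Implicit Type L : {scalar {poly {fraction {poly R}}}}.

Local Arguments xcoef : simpl never.

Lemma Xn_expand_frac n :
  'X^n = \sum_(k < n.+1) tofrac (xcoef q n k) *: Frat q k.
Proof.
rewrite -(map_polyXn (@tofrac {poly R})) (Xn_expand q) rmorph_sum.
by apply: eq_bigr => k _; rewrite /= map_polyZ.
Qed.

Lemma dual_functional_Xn L n :
  is_dual_functional q L -> L 'X^n = tofrac (xcoef q n 0).
Proof.
move=> dualL; rewrite Xn_expand_frac linear_sum big_ord_recl linearZ dualL.
by rewrite big1 ?addr0 => [|k _] /=; rewrite ?linearZ ?dualL /= ?mulr1 ?mulr0.
Qed.

(** In the expansion of x^(n+1) the coefficient of F_(n+1) is 1. By strong induction L kills F_1,
    ..., F_n, so L(x^(n+1)) = a(n+1, 0) + L(F_(n+1)), which forces L(F_(n+1)) = 0. *)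
Lemma is_dual_functionalP L :
  (forall n, L 'X^n = tofrac (xcoef q n 0)) -> is_dual_functional q L.
Proof.
move=> LX; elim/ltn_ind => -[|n] IHn.
  have -> : Frat q 0 = 'X^0 by rewrite /Frat rmorph1.
  by rewrite LX rmorph1.
have := LX n.+1; rewrite Xn_expand_frac linear_sum big_ord_recr big_ord_recl.
rewrite /= xcoef_diag rmorph1 scale1r linearZ (IHn 0%N) //= mulr1.
rewrite big1 => [|k _].
  by rewrite addr0 => /(canRL (addKr _)); rewrite addNr.
by rewrite linearZ IHn /= ?mulr0 // /bump /= add1n ltnS.
Qed.

Lemma dual_functional_unique L L' :
  is_dual_functional q L -> is_dual_functional q L' -> L' =1 L.
Proof.
move=> dualL dualL'; apply: scalar_eq_on_Xn => n.
by rewrite !dual_functional_Xn.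
Qed.
End DualFunctional.

Theorem theorem1 (R : realType) (q : R) (hq0 : 0 < q) (hq1 : q < 1) :
  [/\ forall n : nat,
        F q (2 * n)%N =
        \sum_(0 <= k < n.+1)
          (((-1) ^+ k * q ^+ 'C(k, 2)) *:
             \sum_(0 <= j < k.+1)
               (qbinom q (n%:Z - j%:Z) (k%:Z - j%:Z)
                * qbinom q (n%:Z - k%:Z + j%:Z - 1) j%:Z
                * q ^+ ((n - k + 1) * j)) *: 'X^j)
          *: 'X^(2 * n - 2 * k),
      forall n : nat,
        F q (2 * n + 1)%N =
        \sum_(0 <= k < n.+1)
          (((-1) ^+ k * q ^+ 'C(k, 2)) *:
             \sum_(0 <= j < k.+1)
               (qbinom q (n%:Z - j%:Z) (k%:Z - j%:Z)
                * qbinom q (n%:Z - k%:Z + j%:Z) j%:Z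
                * q ^+ ((n - k + 1) * j)) *: 'X^j)
          *: 'X^(2 * n + 1 - 2 * k),
      exists L : {scalar {poly {fraction {poly R}}}},
        is_dual_functional q L
        /\ (forall L' : {scalar {poly {fraction {poly R}}}},
              is_dual_functional q L' -> L' =1 L)
    & forall L : {scalar {poly {fraction {poly R}}}},
        is_dual_functional q L ->
        forall n : nat,
          L 'X^(2 * n) = tofrac (Catalan q n) /\ L 'X^(2 * n + 1) = 0].
Proof.
split.
- by move=> n; have [] := F_explicit hq0 hq1 n.
- by move=> n; have [] := F_explicit hq0 hq1 n.
(* The moments are forced by [dual_functional_Xn], so the witness is the functional with exactly
   these moments. *)
- pose m n := tofrac (xcoef q n 0).
  have dualL : is_dual_functional q (moment_functional m).
    by apply: is_dual_functionalP => n; exact: moment_functional_Xn.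
  by exists (moment_functional m); split=> // L'; apply: dual_functional_unique.
- move=> L dualL n; rewrite !(dual_functional_Xn _ dualL).
  by rewrite (xcoef_Catalan hq0 hq1) xcoef_odd0.
Qed.
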